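(* Let $\mathscr{P}=(A,B,C)$ be a linear time-invariant system with $A\in\mathbb{R}^{n\times n}$, $B\in\mathbb{R}^{n\times m}$, $C\in\mathbb{R}^{q\times n}$, and let $N>1$. If $N$ is even, then $\mathscr{P}^N$ is output-feedback synchronizable if and only if the system $\mathscr{P}$ is output-feedback stabilizable.
   Context: Graphs: $\mathcal{G}^N$ is the set of directed weighted graphs on nodes $\{1,\dots,N\}$ given by a weighted adjacency matrix $\Sigma=(\sigma_{i,j})\in\mathbb{R}^{N\times N}$ with $\sigma_{i,i}=0$ for all $i$ ($(i,j)$ is an edge iff $\sigma_{i,j}\neq0$). Weights may be negative and $\Sigma$ need not be symmetric. Network: for $K\in\mathbb{R}^{m\times q}$ and $\mathscr{G}\in\mathcal{G}^N$, the network $(\mathscr{P}^N,K,\mathscr{G})$ consists of $N$ copies of the system, $\dot x_i=Ax_i+Bu_i$, $y_i=Cx_i$, $x_i\in\mathbb{R}^n$, $u_i\in\mathbb{R}^m$, $y_i\in\mathbb{R}^q$, $i=1,\dots,N$, coupled by $u_i=K\sum_{j=1}^N\sigma_{i,j}(y_j-y_i)$. It is said to synchronize if $\lim_{t\to\infty}(x_i(t)-x_j(t))=0$ for all $i,j$ and all initial conditions. The collection $\mathscr{P}^N$ ($N$ copies of $\mathscr{P}$) is output-feedback synchronizable (OFS) if there exist $K\in\mathbb{R}^{m\times q}$ and $\mathscr{G}\in\mathcal{G}^N$ such that $(\mathscr{P}^N,K,\mathscr{G})$ synchronizes. The system $\mathscr{P}$ is output-feedback stabilizable if there exists $K\in\mathbb{R}^{m\times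 q}$ such that $A-BKC$ is Hurwitz (all eigenvalues have strictly negative real part). *)

(* Defs.v *)
(* MathComp / MathComp-Analysis. *)
From mathcomp Require Import all_boot all_order all_algebra.
From mathcomp Require Import all_classical all_reals all_analysis.
From mathcomp Require Import complex.

Set Implicit Arguments.
Unset Strict Implicit.
Unset Printing Implicit Defensive.

Import Order.TTheory GRing.Theory Num.Theory.
Import numFieldNormedType.Exports.

Local Open Scope classical_set_scope.
Local Open Scope ring_scope.

(* Spectrum taken over R[i]: eigenvalues of a real matrix may be complex. *)
Definition hurwitz (R : realType) (n : nat) (M : 'M[R]_n) : Prop :=
  forall z : R[i],
    eigenvalue (map_mx (real_complex R) M) z -> complex.Re z < 0.

Definition output_feedback_stabilizable (R : realType) (n m q : nat)
    (A : 'M[R]_n) (B : 'M[R]_(n, m)) (C : 'M[R]_(q, n)) : Prop :=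
  exists K : 'M[R]_(m, q), hurwitz (A - B *m K *m C).

(* Weighted adjacency matrix of a directed graph without self-loops: (i, j) is
   an edge iff S i j != 0. Weights may be negative, S need not be symmetric. *)
Definition adjacency (R : realType) (N : nat) (S : 'M[R]_N) : Prop :=
  forall i, S i i = 0.

Definition coupling (R : realType) (N m q : nat) (K : 'M[R]_(m, q))
    (S : 'M[R]_N) (y : 'I_N -> 'cV[R]_q) (i : 'I_N) : 'cV[R]_m :=
  K *m \sum_(j < N) S i j *: (y j - y i).

(* x is the trajectory on [0, +oo[ issued from x0: the values at t < 0 are
   irrelevant, the equation holds for t > 0, and x is right-continuous at 0
   (so the equation also holds there with the right derivative). *)
Definition network_trajectory (R : realType) (N n m q : nat)
    (A : 'M[R]_n) (B : 'M[R]_(n, m)) (C : 'M[R]_(q, n))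
    (K : 'M[R]_(m, q)) (S : 'M[R]_N)
    (x0 : 'I_N -> 'cV[R]_n) (x : 'I_N -> R -> 'cV[R]_n) : Prop :=
  forall i : 'I_N,
    [/\ x i 0 = x0 i,
        x i t @[t --> (0 : R)^'+] --> x0 i &
        forall t : R, 0 < t ->
          is_derive t (1 : R) (x i)
            (A *m x i t + B *m coupling K S (fun j => C *m x j t) i)].

(* The network is a linear ODE, so every x0 has exactly one trajectory on
   [0, +oo[; quantifying over all trajectories is not vacuous. *)
Definition synchronizes (R : realType) (N n m q : nat)
    (A : 'M[R]_n) (B : 'M[R]_(n, m)) (C : 'M[R]_(q, n))
    (K : 'M[R]_(m, q)) (S : 'M[R]_N) : Prop :=
  forall (x0 : 'I_N -> 'cV[R]_n) (x : 'I_N -> R -> 'cV[R]_n),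
    network_trajectory A B C K S x0 x ->
    forall i j : 'I_N, x i t - x j t @[t --> +oo] --> (0 : 'cV[R]_n).

Definition output_feedback_synchronizable (R : realType) (N n m q : nat)
    (A : 'M[R]_n) (B : 'M[R]_(n, m)) (C : 'M[R]_(q, n)) : Prop :=
  exists (K : 'M[R]_(m, q)) (S : 'M[R]_N),
    adjacency S /\ synchronizes A B C K S.
Arguments output_feedback_synchronizable {R} N {n m q} A B C.

(* Main.v *)
Require Import Defs.
From mathcomp Require Import all_boot all_order all_algebra.
From mathcomp Require Import all_classical all_reals all_analysis.
From mathcomp Require Import complex polyrcf ring lra.

(** Write L = diag(row sums of S) - S for the Laplacian of the graph and put
    the states of the nodes in the columns of a matrix X.  The network is the
    linear equation X' = A X - B K C X L^T.

    Let the network synchronize.  The rows w with w 1 = 0 form a space of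
    dimension N - 1, stable under w |-> w L because L 1 = 0.  When N is even
    this dimension is odd, so the induced real operator has a real eigenvalue
    lam: w L = lam w with w != 0
    ([odd_hyperplane_left_eigenvector]).  The combination z = X w^T of the
    states satisfies z' = (A - B (lam K) C) z, has an arbitrary initial value,
    and tends to 0 because w 1 = 0 makes it a combination of the differences
    x_i - x_0.  A linear system all of whose solutions vanish at infinity is
    Hurwitz ([hurwitz_of_cvg0]), so the real gain lam K stabilizes the system
    ([hurwitz_of_synchronizes]).  For this, trajectories with a prescribed
    initial value have to exist; they are given by the exponential series
    ([linear_ode_exists]).

    Conversely, let K stabilize the system and let every node follow node 0 in
    a star graph: each difference x_i - x_0 obeys e' = (A - B K C) e, and the
    solutions of a Hurwitz system vanish at infinity
    ([star_graph_synchronizes], [hurwitz_cvg0]).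

    Both statements about Hurwitz matrices M come from one computation.  For a
    complex row v with v M = mu v + v', the function |v z|^2 has derivative
    2 Re(mu) |v z|^2 + 2 Re(conj(v z) (v' z)) along solutions of z' = M z.  If
    v' = 0 and Re(mu) >= 0 it does not decrease.  If Re(mu) < 0 and v' z tends
    to 0, so does v z; peeling off the linear factors of the characteristic
    polynomial, which annihilates M by Cayley-Hamilton, this reaches every
    coordinate of z without any normal form of M. *)

Set Implicit Arguments.
Unset Strict Implicit.
Unset Printing Implicit Defensive.

Import Order.TTheory GRing.Theory Num.Theory.
Import numFieldNormedType.Exports.

Local Open Scope classical_set_scope.
Local Open Scope ring_scope.

(** * Matrix-valued functions *)

Lemma is_derive_mxP (R : realType) (m n : nat) (X : R -> 'M[R]_(m, n)) (t : R)
    (D : 'M[R]_(m, n)) :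
  is_derive t 1 X D <-> forall i j, is_derive t 1 (fun s => X s i j) (D i j).
Proof.
split=> [[dX <-] i j|dX].
  apply: DeriveDef; first exact: (derivable_mxP X t 1).1.
  by rewrite derive_mx// mxE.
have dX' : derivable X t 1.
  by apply/derivable_mxP => i j; have [] := dX i j.
apply: DeriveDef => //; rewrite derive_mx//; apply/matrixP => i j.
by rewrite mxE; have [] := dX i j.
Qed.

Lemma linear_mxE (R : realType) (m n p q : nat)
    (f : {linear 'M[R]_(m, n) -> 'M[R]_(p, q)}) (X : 'M[R]_(m, n)) k l :
  f X k l = \sum_i \sum_j X i j * f (delta_mx i j) k l.
Proof.
rewrite {1}(matrix_sum_delta X) linear_sum summxE; apply: eq_bigr => i _.
by rewrite linear_sum summxE; apply: eq_bigr => j _; rewrite linearZ mxE.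
Qed.

Lemma is_derive_linear (R : realType) (m n p q : nat)
    (f : {linear 'M[R]_(m, n) -> 'M[R]_(p, q)})
    (X : R -> 'M[R]_(m, n)) (t : R) (D : 'M[R]_(m, n)) :
  is_derive t 1 X D -> is_derive t 1 (fun s => f (X s)) (f D).
Proof.
move=> /is_derive_mxP dX; apply/is_derive_mxP => k l.
have -> : (fun s => f (X s) k l) =
    \sum_i \sum_j (f (delta_mx i j) k l *: (fun s => X s i j)).
  apply/funext => s; rewrite linear_mxE fct_sumE; apply: eq_bigr => i _.
  by rewrite fct_sumE; apply: eq_bigr => j _; rewrite mulrC.
rewrite linear_mxE; apply: is_derive_sum => i; apply: is_derive_sum => j.
by rewrite mulrC; apply: is_deriveZ.
Qed.

Lemma cvg_mxP (R : realType) (m n : nat) (T : Type) (F : set_system T)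
    {FF : Filter F} (X : T -> 'M[R]_(m, n)) (L : 'M[R]_(m, n)) :
  X x @[x --> F] --> L <-> forall i j, X x i j @[x --> F] --> L i j.
Proof.
split=> [XL i j|XL].
  by apply: (cvg_comp X (fun M : 'M[R]_(m, n) => M i j) XL); exact: coord_continuous.
apply/cvgrPdist_le => e e0; near=> x.
rewrite /Num.Def.normr/= mx_normrE (bigmax_le _ (ltW e0))//= => i _.
rewrite !mxE/=.
move: i; near: x; apply: filter_forall => /= i.
exact: ((cvgrPdist_le _ _).1 (XL i.1 i.2)).
Unshelve. all: by end_near. Qed.

Lemma cvg_linear (R : realType) (m n p q : nat)
    (f : {linear 'M[R]_(m, n) -> 'M[R]_(p, q)}) (T : Type) (F : set_system T)
    {FF : Filter F} (X : T -> 'M[R]_(m, n)) (L : 'M[R]_(m, n)) :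
  X x @[x --> F] --> L -> f (X x) @[x --> F] --> f L.
Proof.
move=> /cvg_mxP XL; apply/cvg_mxP => k l; rewrite linear_mxE.
under eq_fun do rewrite linear_mxE.
apply: cvg_big => [|i _]; first exact: add_continuous.
apply: cvg_big => [|j _]; first exact: add_continuous.
by apply: cvgM; [exact: XL|exact: cvg_cst].
Qed.

Arguments cvg_linear {R m n p q} f {T F FF X L}.

(** * Decay of solutions and the spectrum *)

(** Gronwall-type argument: once eta <= - a e / 2, the function
    exp(- a t) (V t - e / 2) is nonincreasing, so V t is at most e / 2 plus a
    multiple of exp(a t). *)
Lemma cvg0_of_deriv_le (R : realType) (V dV eta : R -> R) (a : R) :
  a < 0 -> (forall t, 0 <= V t) ->
  (forall t : R, 0 < t -> is_derive t 1 V (dV t)) ->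
  (forall t : R, 0 < t -> dV t <= a * V t + eta t) ->
  eta t @[t --> +oo] --> 0 -> V t @[t --> +oo] --> 0.
Proof.
move=> a0 V0 VdV dVle eta0; apply/cvgrPdist_le => e e0.
have e20 : 0 < e / 2 by rewrite divr_gt0.
have eta_le : \forall t \near +oo, eta t <= - a * (e / 2).
  have ae : 0 < - a * (e / 2) by rewrite mulr_gt0// oppr_gt0.
  move/cvgrPdist_le : eta0 => /(_ _ ae); apply: filterS => t.
  by rewrite sub0r normrN => /(le_trans (ler_norm _)).
have [T [T0 etaT]] : exists T : R, 0 < T /\ forall t, T <= t -> eta t <= - a * (e / 2).
  case: eta_le => M [_ HM]; exists (Num.max 1 (M + 1)); split.
    by rewrite lt_max ltr01.
  move=> t; rewrite ge_max => /andP[_ Mt]; apply: HM.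
  by rewrite (lt_le_trans _ Mt)// ltrDl.
pose G (t : R) := expR (- a * t) * (V t - e / 2).
pose dG (t : R) := expR (- a * t) * (- a * (V t - e / 2) + dV t).
have GdG (t : R) : 0 < t -> is_derive t 1 G (dG t).
  move=> t0; have := VdV t t0 => ?.
  rewrite /G /dG.
  have dE : is_derive t 1 (fun s => expR (- a * s)) (expR (- a * t) * - a).
    have dm : is_derive t 1 (fun s => - a * s) (- a).
      have := @is_deriveZ _ _ _ (@id R) (- a) t 1 1 _.
      by rewrite [_ *: 1]mulr1; apply.
    exact: (@is_derive1_comp _ expR (fun s => - a * s)).
  have dV1 : is_derive t 1 (fun s => V s - e / 2) (dV t).
    by rewrite -[dV t]subr0; apply: is_deriveB.
  have := is_deriveM dE dV1; congr is_derive.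
  by rewrite /GRing.scale/=; ring.
have G_le (t : R) : T <= t -> G t <= G T.
  move=> Tt; have Gd (s : R) : s \in `]T, t[%R -> is_derive s 1 G (dG s).
    by move=> /itvP sT; apply: GdG; rewrite (lt_trans T0)// sT.
  apply: (@ler0_derive1_le_cc R G T t) => //.
  - by move=> s /Gd[].
  - move=> s sTt; rewrite derive1E; have [_ ->] := Gd s sTt.
    have Ts : T <= s by rewrite (itvP sTt).
    rewrite /dG mulr_ge0_le0 ?expR_ge0//.
    have := dVle s (lt_le_trans T0 Ts); have := etaT s Ts.
    by move: (V s) (dV s) (eta s) => x y z; lra.
  - apply: derivable_within_continuous => s sTt.
    apply: (@ex_derive _ _ _ _ _ _ (dG s)); apply: GdG.
    by rewrite (lt_le_trans T0)// (itvP sTt).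
  - by rewrite in_itv/= lexx Tt.
  - by rewrite in_itv/= lexx Tt.
have tail : expR (a * t) * G T @[t --> +oo] --> 0.
  rewrite -[X in _ --> X](mul0r (G T)); apply: cvgM; [|exact: cvg_cst].
  have -> : (fun t => expR (a * t)) = (fun s => expR (- s)) \o (fun t => - a * t).
    by apply/funext => s /=; rewrite mulNr opprK.
  apply: cvg_comp (@cvgr_expR R).
  by apply: gt0_cvgMry; [rewrite oppr_gt0|exact: cvg_id].
near=> t.
rewrite sub0r normrN ger0_norm ?V0//.
have Tt : T <= t by near: t; apply: nbhs_pinfty_ge; rewrite num_real.
have tl : expR (a * t) * G T <= e / 2.
  near: t; move/cvgrPdist_le : tail => /(_ _ e20); apply: filterS => t.
  by rewrite sub0r normrN => /(le_trans (ler_norm _)).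
have := G_le t Tt; rewrite /G.
rewrite -(ler_pM2l (expR_gt0 (a * t))) mulrA -expRD -mulrDl subrr mul0r expR0 mul1r.
rewrite -/(G T); move: tl; move: (_ * _) => x; lra.
Unshelve. all: by end_near. Qed.

Local Notation toC := (real_complex _).

(** A complex linear form read on a real vector. *)
Definition obs (R : realType) (n : nat) (v : 'rV[R[i]]_n) (z : 'cV[R]_n) : R[i] :=
  (v *m map_mx toC z) 0 0.

Lemma Re_obs (R : realType) (n : nat) (v : 'rV[R[i]]_n) (z : 'cV[R]_n) :
  complex.Re (obs v z) = (map_mx (@complex.Re R) v *m z) 0 0.
Proof.
rewrite /obs !mxE (raddf_sum (@complex.Re R : Rcomplex R -> R)).
by apply: eq_bigr => j _; rewrite !mxE; case: (v 0 j) => a b /=; ring.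
Qed.

Lemma Im_obs (R : realType) (n : nat) (v : 'rV[R[i]]_n) (z : 'cV[R]_n) :
  complex.Im (obs v z) = (map_mx (@complex.Im R) v *m z) 0 0.
Proof.
rewrite /obs !mxE (raddf_sum (@complex.Im R : Rcomplex R -> R)).
by apply: eq_bigr => j _; rewrite !mxE; case: (v 0 j) => a b /=; ring.
Qed.

Definition sqmod (R : realType) (w : R[i]) : R :=
  complex.Re w ^+ 2 + complex.Im w ^+ 2.

Lemma sqmod_ge0 (R : realType) (w : R[i]) : 0 <= sqmod w.
Proof. by rewrite addr_ge0// sqr_ge0. Qed.

Lemma sqmod_gt0 (R : realType) (w : R[i]) : w != 0 -> 0 < sqmod w.
Proof.
move=> w0; rewrite lt_neqAle sqmod_ge0 andbT eq_sym /sqmod.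
rewrite paddr_eq0 ?sqr_ge0// !sqrf_eq0.
by apply: contra w0 => ?; rewrite eq_complex.
Qed.

(** The form v evolves by (v z)' = mu (v z) + v' z; the imaginary part of
    mu only rotates v z, so it drops out of the squared modulus. *)
Lemma is_derive_sqmod_obs (R : realType) (n : nat) (M : 'M[R]_n) (mu : R[i])
    (v v' : 'rV[R[i]]_n) (z : R -> 'cV[R]_n) (t : R) :
  v *m map_mx toC M = mu *: v + v' ->
  is_derive t 1 z (M *m z t) ->
  is_derive t 1 (fun s => sqmod (obs v (z s)))
    (2 * (complex.Re mu * sqmod (obs v (z t)) +
          complex.Re (obs v (z t)) * complex.Re (obs v' (z t)) +
          complex.Im (obs v (z t)) * complex.Im (obs v' (z t)))).
Proof.
move=> vM dz.
have obsM : obs v (M *m z t) = mu * obs v (z t) + obs v' (z t).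
  by rewrite /obs map_mxM mulmxA vM mulmxDl -scalemxAl !mxE.
have dRe : is_derive t 1 (fun s => complex.Re (obs v (z s)))
    (complex.Re (obs v (M *m z t))).
  under eq_fun do rewrite Re_obs.
  rewrite Re_obs.
  by move/(is_derive_linear (mulmx (map_mx (@complex.Re R) v)))/is_derive_mxP : dz; exact.
have dIm : is_derive t 1 (fun s => complex.Im (obs v (z s)))
    (complex.Im (obs v (M *m z t))).
  under eq_fun do rewrite Im_obs.
  rewrite Im_obs.
  by move/(is_derive_linear (mulmx (map_mx (@complex.Im R) v)))/is_derive_mxP : dz; exact.
rewrite (_ : (fun s => _) = (fun s => complex.Re (obs v (z s))) ^+ 2 +
    (fun s => complex.Im (obs v (z s))) ^+ 2); last exact/funext.
apply: is_derive_eq.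
rewrite obsM /sqmod; case: (obs v (z t)) => a b; case: (obs v' (z t)) => c d.
by case: mu {vM obsM} => p q; rewrite /GRing.scale/=; ring.
Qed.

(** Induction on the factors: v' = v (M - mu) has one factor fewer, so v' z
    tends to 0, and v z is driven by v' z through a stable scalar equation. *)
Lemma cvg_obs0_of_factors (R : realType) (n : nat) (M : 'M[R]_n)
    (z : R -> 'cV[R]_n) (s : seq R[i]) :
  (forall t : R, 0 < t -> is_derive t 1 z (M *m z t)) ->
  (forall mu, mu \in s -> complex.Re mu < 0) ->
  forall v : 'rV[R[i]]_n,
    foldl (fun u mu => u *m map_mx toC M - mu *: u) v s = 0 ->
  sqmod (obs v (z t)) @[t --> +oo] --> 0.
Proof.
move=> dz; elim: s => [|mu s IHs] Res v /=.
  move=> ->; under eq_fun do rewrite /obs mul0mx mxE /sqmod /= expr0n addr0.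
  exact: cvg_cst.
set v' := v *m _ - _ => v'0.
have vM : v *m map_mx toC M = mu *: v + v' by rewrite /v' addrC subrK.
have Remu : complex.Re mu < 0 by apply: Res; rewrite mem_head.
have {IHs v'0} v'cvg : sqmod (obs v' (z t)) @[t --> +oo] --> 0.
  by apply: IHs => // nu nus; apply: Res; rewrite in_cons nus orbT.
apply: (@cvg0_of_deriv_le _ _ _
    (fun t => - (complex.Re mu)^-1 * sqmod (obs v' (z t))) _ Remu).
- by move=> t; exact: sqmod_ge0.
- by move=> t t0; apply: (is_derive_sqmod_obs vM); exact: dz.
- move=> t _; rewrite /sqmod; move: (complex.Re mu) Remu => a a0.
  case: (obs v (z t)) => p q; case: (obs v' (z t)) => c d /=.
  (* Young's inequality with weight - a: 2 (p c + q d) is bounded by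
     - a (p^2 + q^2) - (c^2 + d^2) / a, and the gap is a sum of squares. *)
  rewrite -subr_ge0 (_ : _ - _ = - a^-1 * ((a * p + c) ^+ 2 + (a * q + d) ^+ 2)).
    by rewrite mulr_ge0 ?addr_ge0 ?sqr_ge0// oppr_ge0 invr_le0 ltW.
  by field; rewrite lt_eqF.
- rewrite -(mulr0 (- (complex.Re mu)^-1)).
  by apply: cvgM => //; exact: cvg_cst.
Qed.

Lemma foldl_linear_factors (R : realType) (n : nat) (M : 'M[R[i]]_n.+1) (s : seq R[i])
    (v : 'rV[R[i]]_n.+1) :
  foldl (fun u mu => u *m M - mu *: u) v s =
  v *m horner_mx M (\prod_(mu <- s) ('X - mu%:P)).
Proof.
elim: s v => [|mu s IHs] v /=; first by rewrite big_nil rmorph1 mulmx1.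
rewrite IHs big_cons rmorphM /= rmorphB /= horner_mx_X horner_mx_C.
by rewrite mulmxA mulmxBr mul_mx_scalar.
Qed.

Lemma cvg0_of_sqr (R : realType) (f : R -> R) :
  f t ^+ 2 @[t --> +oo] --> 0 -> f t @[t --> +oo] --> 0.
Proof.
move=> f0; apply/cvgrPdist_le => e e0.
move/cvgrPdist_le : f0 => /(_ _ (exprn_gt0 2 e0)); apply: filterS => t.
by rewrite !sub0r !normrN normrX ler_sqr// nnegrE ltW.
Qed.

Lemma hurwitz_cvg0 (R : realType) (n : nat) (M : 'M[R]_n) (z : R -> 'cV[R]_n) :
  hurwitz M -> (forall t : R, 0 < t -> is_derive t 1 z (M *m z t)) ->
  z t @[t --> +oo] --> (0 : 'cV[R]_n).
Proof.
case: n M z => [|n] M z HM dz.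
  by apply/cvg_mxP => -[].
have [s chM] := closed_field_poly_normal (char_poly (map_mx toC M)).
rewrite (monicP (char_poly_monic _)) scale1r in chM.
apply/cvg_mxP => k j; rewrite ord1 mxE; apply: cvg0_of_sqr.
have HE t : z t k 0 ^+ 2 = sqmod (obs (delta_mx 0 k) (z t)).
  by rewrite /obs -rowE !mxE /sqmod /= expr0n addr0.
under eq_fun do rewrite HE.
apply: (@cvg_obs0_of_factors _ _ M z s) => //.
  move=> mu mus; apply: HM; rewrite eigenvalue_root_char chM.
  by rewrite root_prod_XsubC.
by rewrite foldl_linear_factors -chM Cayley_Hamilton mulmx0.
Qed.

(** If v is a left eigenvector for mu with Re(mu) >= 0, then |v z|^2 is
    nondecreasing along solutions; starting from a coordinate vector on which v
    does not vanish, it stays away from 0. *)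
Lemma hurwitz_of_cvg0 (R : realType) (n : nat) (M : 'M[R]_n) :
  (forall zeta : 'cV[R]_n, exists z : R -> 'cV[R]_n,
     [/\ z 0 = zeta, forall t : R, is_derive t 1 z (M *m z t) &
         z t @[t --> +oo] --> (0 : 'cV[R]_n)]) ->
  hurwitz M.
Proof.
move=> sol mu /eigenvalueP[v vM v0]; rewrite ltNge; apply/negP => Remu.
have [k vk] : exists k, v 0 k != 0.
  by move/rV0Pn : v0.
have [z [z0 dz zcvg]] := sol (delta_mx k 0).
pose V t := sqmod (obs v (z t)).
have dV (t : R) : is_derive t 1 V (2 * (complex.Re mu * V t)).
  have vM' : v *m map_mx toC M = mu *: v + 0 by rewrite addr0.
  have := is_derive_sqmod_obs vM' (dz t).
  by rewrite {4 6}/obs mul0mx mxE /= !mulr0 !addr0.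
have V0 : 0 < V 0.
  by rewrite sqmod_gt0// /obs z0 map_delta_mx -colE mxE.
have V_ge (t : R) : 0 <= t -> V 0 <= V t.
  move=> t0; apply: (@ger0_derive1_ndecry R V 0) => //.
  - move=> s _; rewrite derive1E; have [_ ->] := dV s.
    by rewrite !mulr_ge0// sqmod_ge0.
  - by apply: derivable_within_continuous => s _; have [] := dV s.
have Vcvg : V t @[t --> +oo] --> 0.
  rewrite (_ : 0 = 0 * 0 + 0 * 0); last by rewrite mulr0 addr0.
  rewrite /V /sqmod.
  move/(cvg_linear (mulmx (map_mx (@complex.Re R) v)))/cvg_mxP : (zcvg) => Rz.
  move/(cvg_linear (mulmx (map_mx (@complex.Im R) v)))/cvg_mxP : (zcvg) => Iz.
  apply: cvgD; apply: cvgM.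
  - by under eq_fun do rewrite Re_obs; have := Rz 0 0; rewrite /= mulmx0 mxE; apply.
  - by under eq_fun do rewrite Re_obs; have := Rz 0 0; rewrite /= mulmx0 mxE; apply.
  - by under eq_fun do rewrite Im_obs; have := Iz 0 0; rewrite /= mulmx0 mxE; apply.
  - by under eq_fun do rewrite Im_obs; have := Iz 0 0; rewrite /= mulmx0 mxE; apply.
move/cvgrPdist_lt : Vcvg => /(_ _ V0) VltV0.
near (pinfty_nbhs R) => t.
have : `|0 - V t| < V 0 by near: t.
apply/negP; rewrite -leNgt sub0r normrN ger0_norm ?sqmod_ge0//; apply: V_ge.
by near: t; apply: nbhs_pinfty_ge; rewrite num_real.
Unshelve. all: by end_near. Qed.

(** * Existence of solutions of linear systems *)

(** The k-th Taylor coefficient at 0 of coordinate i of exp(t F) x. *)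
Definition expmx_coef (R : realType) (p : nat) (F : 'M[R]_p) (x : 'cV[R]_p)
    (i : 'I_p) (k : nat) : R :=
  iter k (mulmx F) x i 0 / k`!%:R.

(** Differentiating the series amounts to replacing x by F x, so every formal
    derivative is again a series of the same kind. *)
Lemma pseries_diffs_expmx_coef (R : realType) (p : nat) (F : 'M[R]_p)
    (x : 'cV[R]_p) (i : 'I_p) :
  pseries_diffs (expmx_coef F x i) = expmx_coef F (F *m x) i.
Proof.
apply/funext => k; rewrite /pseries_diffs /expmx_coef -iterSr.
by rewrite factS natrM invfM mulrCA mulVKf// mulrC.
Qed.

Lemma iter_mulmx_le (R : realType) (p : nat) (F : 'M[R]_p) (x : 'cV[R]_p)
    (k : nat) (i : 'I_p) :
  `|iter k (mulmx F) x i 0| <=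
  (\sum_i \sum_j `|F i j|) ^+ k * \sum_j `|x j 0|.
Proof.
set b := \sum_i _; elim: k i => [|k IHk] i /=.
  by rewrite expr0 mul1r (bigD1 i)//= lerDl sumr_ge0.
rewrite mxE (le_trans (ler_norm_sum _ _ _))//.
rewrite exprS -mulrA.
apply: (@le_trans _ _ ((\sum_j `|F i j|) * (b ^+ k * \sum_j `|x j 0|))).
  by rewrite mulr_suml; apply: ler_sum => j _; rewrite normrM ler_wpM2l.
rewrite ler_wpM2r//.
  by rewrite mulr_ge0 ?exprn_ge0 ?sumr_ge0// => ? _; exact: sumr_ge0.
by rewrite /b [leRHS](bigD1 i)//= lerDl sumr_ge0// => ? _; exact: sumr_ge0.
Qed.

Lemma is_cvg_expmx (R : realType) (p : nat) (F : 'M[R]_p) (x : 'cV[R]_p)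
    (i : 'I_p) (t : R) : cvgn (pseries (expmx_coef F x i) t).
Proof.
apply: normed_cvg.
set b := \sum_i \sum_j `|F i j|; set c := \sum_j `|x j 0|.
apply: (@series_le_cvg _ _ (c *: exp_coeff (b * `|t|))).
- by move=> k /=.
- move=> k; rewrite -[leRHS]/(c * exp_coeff (b * `|t|) k).
  rewrite mulr_ge0 ?sumr_ge0// exp_coeff_ge0// mulr_ge0// sumr_ge0//.
  by move=> ? _; exact: sumr_ge0.
- move=> k /=; rewrite -[leRHS]/(c * ((b * `|t|) ^+ k / k`!%:R)).
  rewrite /expmx_coef !normrM normfV.
  rewrite normrX (ger0_norm (ler0n _ _)) exprMn.
  rewrite (_ : c * _ = b ^+ k * c * (k`!%:R^-1 * `|t| ^+ k)); last by ring.
  by rewrite -mulrA ler_wpM2r ?iter_mulmx_le// mulr_ge0 ?invr_ge0 ?exprn_ge0.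
- by apply: is_cvg_seriesZ; exact: is_cvg_series_exp_coeff.
Qed.

(** The matrix exponential exp(t F) applied to x. *)
Definition linear_flow (R : realType) (p : nat) (F : 'M[R]_p) (x : 'cV[R]_p)
    (t : R) : 'cV[R]_p :=
  \col_i limn (pseries (expmx_coef F x i) t).

Lemma linear_flow0 (R : realType) (p : nat) (F : 'M[R]_p) (x : 'cV[R]_p) :
  linear_flow F x 0 = x.
Proof.
apply/colP => i; rewrite mxE; apply: lim_near_cst => //.
near=> m; rewrite -[m]prednK; last by near: m; exists 1%N.
rewrite /pseries /series /= big_nat_recl//= big1 ?addr0.
  by rewrite /expmx_coef /= expr0 mulr1 fact0 divr1.
by move=> k _; rewrite expr0n mulr0.
Unshelve. all: by end_near. Qed.

Lemma linear_flow_mulmx (R : realType) (p : nat) (F : 'M[R]_p) (x : 'cV[R]_p)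
    (t : R) : linear_flow F (F *m x) t = F *m linear_flow F x t.
Proof.
apply/colP => i; rewrite !mxE; apply: cvg_lim => //.
have -> : pseries (expmx_coef F (F *m x) i) t =
    (fun m => \sum_j F i j * pseries (expmx_coef F x j) t m).
  apply/funext => m; rewrite /pseries /series /=.
  under [RHS]eq_bigr do rewrite mulr_sumr.
  rewrite exchange_big/=; apply: eq_bigr => k _.
  rewrite /expmx_coef -iterSr /= mxE !mulr_suml.
  by apply: eq_bigr => j _; rewrite !mulrA.
apply: cvg_big => [|j _]; first exact: add_continuous.
by rewrite mxE; apply: cvgM; [exact: cvg_cst|exact: is_cvg_expmx].
Qed.

Lemma is_derive_linear_flow (R : realType) (p : nat) (F : 'M[R]_p)
    (x : 'cV[R]_p) (t : R) :
  is_derive t 1 (linear_flow F x) (F *m linear_flow F x t).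
Proof.
rewrite -linear_flow_mulmx; apply/is_derive_mxP => i j.
under eq_fun do rewrite mxE; rewrite mxE -pseries_diffs_expmx_coef.
apply: (@pseries_snd_diffs _ _ (`|t| + 1)); rewrite ?pseries_diffs_expmx_coef.
- exact: is_cvg_expmx.
- exact: is_cvg_expmx.
- exact: is_cvg_expmx.
- by rewrite [ltRHS]ger0_norm ?ltrDl// addr_ge0.
Qed.

(** A linear vector field on matrices becomes a square matrix acting on
    flattened rows; the transpositions pass to the columns on which
    [linear_flow] acts. *)
Lemma linear_ode_exists (R : realType) (m n : nat)
    (f : {linear 'M[R]_(m, n) -> 'M[R]_(m, n)}) (X0 : 'M[R]_(m, n)) :
  exists X : R -> 'M[R]_(m, n),
    X 0 = X0 /\ forall t : R, is_derive t 1 X (f (X t)).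
Proof.
pose g := linear_flow (lin_mx f)^T (mxvec X0)^T.
exists (fun t => vec_mx (g t)^T); split.
  by rewrite /g linear_flow0 trmxK mxvecK.
move=> t; rewrite (_ : f _ = vec_mx ((lin_mx f)^T *m g t)^T).
  exact/(is_derive_linear vec_mx)/(is_derive_linear trmx)/is_derive_linear_flow.
by rewrite trmx_mul trmxK mul_rV_lin mxvecK.
Qed.

(** * The Laplacian *)

(** The rows of U form a basis of the rows w with w 1 = 0, and D, which drops
    the first entry, gives the coordinates in this basis.  So U L D is the
    matrix of w |-> w L on this hyperplane, and its characteristic polynomial
    is real of odd degree k, hence has a real root. *)
Lemma odd_hyperplane_left_eigenvector (R : rcfType) (k : nat) (L : 'M[R]_(1 + k)) :
  odd k -> L *m const_mx 1 = 0 :> 'cV_(1 + k) ->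
  exists (w : 'rV[R]_(1 + k)) (lam : R),
    [/\ w != 0, w *m const_mx 1 = (0 : 'M[R]_(1, 1)) & w *m L = lam *: w].
Proof.
move=> kodd L1.
pose U : 'M[R]_(k, 1 + k) := row_mx (- const_mx 1) 1%:M.
pose D : 'M[R]_(1 + k, k) := col_mx 0 1%:M.
have U1 : U *m const_mx 1 = 0 :> 'cV_k.
  rewrite -[const_mx 1](@vsubmxK _ 1%N k _ (const_mx 1)) mul_row_col mul1mx.
  apply/colP => i; rewrite !mxE big_ord1 !mxE.
  by rewrite mulr1 addrC subrr.
have DU (p : nat) (y : 'M[R]_(p, 1 + k)) :
    y *m const_mx 1 = 0 :> 'cV_p -> y *m D *m U = y.
  rewrite -[y]hsubmxK; move: (lsubmx y) (rsubmx y) => a b.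
  have -> : const_mx 1 = col_mx 1%:M (const_mx 1) :> 'cV[R]_(1 + k).
    by rewrite -col_mx_const; congr col_mx; apply/matrixP => i j; rewrite !ord1 !mxE.
  rewrite mul_row_col mulmx1 => ab0.
  rewrite mul_row_col mulmx0 add0r mulmx1 mul_mx_row mulmx1; congr row_mx.
  by rewrite mulmxN; apply/eqP; rewrite eq_sym -addr_eq0 ab0.
have [|lam lamP] := @odd_poly_root R (char_poly (U *m L *m D)).
  by rewrite size_char_poly /= negbK.
have /eigenvalueP[rho rhoE rho0] : eigenvalue (U *m L *m D) lam.
  by rewrite eigenvalue_root_char.
exists (rho *m U), lam; split.
- apply: contraNneq rho0 => /(congr1 (mulmxr D)) /=.
  by rewrite -mulmxA mul_row_col mulmx0 add0r !mulmx1 mul0mx => /eqP.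
- by rewrite -mulmxA U1 mulmx0.
- rewrite -[LHS]DU; last by rewrite -mulmxA L1 mulmx0.
  by rewrite -(mulmxA rho U L) -(mulmxA rho _ D) rhoE scalemxAl.
Qed.

Definition laplacian (R : realType) (N : nat) (S : 'M[R]_N) : 'M[R]_N :=
  diag_mx (\row_i \sum_j S i j) - S.

Lemma laplacian1 (R : realType) (N : nat) (S : 'M[R]_N) :
  laplacian S *m const_mx 1 = 0 :> 'cV_N.
Proof.
apply/colP => i; rewrite mulmxBl mul_diag_mx !mxE mulr1 -sumrB big1// => j _.
by rewrite mxE mulr1 subrr.
Qed.

Lemma coupling_laplacian (R : realType) (N n m q : nat) (C : 'M[R]_(q, n))
    (K : 'M[R]_(m, q)) (S : 'M[R]_N) (X : 'M[R]_(n, N)) (i : 'I_N) :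
  coupling K S (fun j => C *m col j X) i =
  - (K *m C *m col i (X *m (laplacian S)^T)).
Proof.
rewrite -mulmxA -[RHS]mulmxN; congr mulmx.
transitivity (C *m \sum_j S i j *: (col j X - col i X)).
  by rewrite mulmx_sumr; apply: eq_bigr => j _; rewrite -scalemxAr mulmxBr.
rewrite -[RHS]mulmxN; congr mulmx.
rewrite /laplacian linearB/= tr_diag_mx mulmxBr mul_mx_diag.
apply/colP => a; rewrite summxE !mxE opprB mulr_sumr -sumrB.
by apply: eq_bigr => j _; rewrite !mxE; ring.
Qed.

(** * Synchronization and stabilization *)

Lemma network_trajectory_of_field (R : realType) (N n m q : nat)
    (A : 'M[R]_n) (B : 'M[R]_(n, m)) (C : 'M[R]_(q, n)) (K : 'M[R]_(m, q))
    (S : 'M[R]_N) (X : R -> 'M[R]_(n, N)) :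
  (forall t : R, is_derive t 1 X (A *m X t - B *m K *m C *m X t *m (laplacian S)^T)) ->
  network_trajectory A B C K S (fun i => col i (X 0)) (fun i t => col i (X t)).
Proof.
move=> dX i.
have dXi (t : R) := is_derive_linear (col i) (dX t).
split=> //.
  apply: cvg_at_right_filter.
  have [/derivable1_diffP/differentiable_continuous cX _] := dXi 0.
  exact: cX.
move=> t _; rewrite coupling_laplacian.
rewrite (_ : _ + _ = col i (A *m X t - B *m K *m C *m X t *m (laplacian S)^T)) //.
by rewrite mulmxN !colE !mulmxA [RHS]mulmxBl.
Qed.

(** Synchronization controls only differences of states; subtracting the state
    of node 0 from every column changes X w^T by (w 1) x_0 = 0. *)
Lemma mulmx_tr_sum0 (R : realType) (N n : nat) (X : 'M[R]_(n, N.+1)) (w : 'rV[R]_N.+1) :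
  w *m const_mx 1 = (0 : 'M[R]_(1, 1)) ->
  X *m w^T = (\matrix_(a, i) (col i X - col 0 X) a 0) *m w^T.
Proof.
move=> w1.
have -> : (\matrix_(a, i) (col i X - col 0 X) a 0) = X - col 0 X *m (const_mx 1)^T.
  by apply/matrixP => a i; rewrite !mxE big_ord1 !mxE mulr1.
by rewrite mulmxBl -mulmxA -trmx_mul w1 trmx0 mulmx0 subr0.
Qed.

(** The weights w turn the network into a single copy of the system under the
    feedback gain lam K.  Any initial value of that copy is reached by
    exciting one node of nonzero weight. *)
Lemma hurwitz_of_synchronizes (R : realType) (N n m q : nat)
    (A : 'M[R]_n) (B : 'M[R]_(n, m)) (C : 'M[R]_(q, n)) (K : 'M[R]_(m, q))
    (S : 'M[R]_N.+1) (w : 'rV[R]_N.+1) (lam : R) :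
  w != 0 -> w *m const_mx 1 = (0 : 'M[R]_(1, 1)) ->
  w *m laplacian S = lam *: w ->
  synchronizes A B C K S -> hurwitz (A - B *m (lam *: K) *m C).
Proof.
move=> w0 w1 wL sync; apply: hurwitz_of_cvg0 => zeta.
have [i wi] : exists i, w 0 i != 0 by move/rV0Pn : w0.
have [X [X0 dX]] := linear_ode_exists
  (mulmx A \- (mulmxr (laplacian S)^T \o mulmx (B *m K *m C)))
  ((w 0 i)^-1 *: (zeta *m delta_mx 0 i)).
exists (fun t => X t *m w^T); split.
- rewrite X0 -scalemxAl -mulmxA.
  rewrite (_ : delta_mx 0 i *m w^T = (w 0 i)%:M); last first.
    by apply/matrixP => a b; rewrite -rowE !ord1 !mxE.
  by rewrite mul_mx_scalar scalerA mulVf// scale1r.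
- move=> t; move/(is_derive_linear (mulmxr w^T)) : (dX t); congr is_derive => /=.
  rewrite !mulmxBl mulmxA; congr (_ - _).
  rewrite -(mulmxA _ _ w^T) -trmx_mul wL linearZ/=.
  by rewrite -!scalemxAr -!scalemxAl !mulmxA.
- have traj := network_trajectory_of_field dX.
  under eq_fun do rewrite (mulmx_tr_sum0 _ w1).
  rewrite -(mul0mx n w^T).
  apply: (cvg_linear (mulmxr w^T)); apply/cvg_mxP => a j; rewrite mxE.
  under eq_fun do rewrite mxE.
  have /cvg_mxP/(_ a 0) := sync _ _ traj j 0.
  by rewrite mxE.
Qed.

(** Node 0 runs freely and the other nodes follow it, which makes each
    difference x_i - x_0 obey an equation of its own. *)
Definition star_graph (R : realType) (N : nat) : 'M[R]_N.+1 :=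
  \matrix_(i, j) ((j == 0) && (i != 0))%:R.

Lemma coupling_star_graph (R : realType) (N m q : nat) (K : 'M[R]_(m, q))
    (y : 'I_N.+1 -> 'cV[R]_q) (i : 'I_N.+1) :
  coupling K (star_graph R N) y i = K *m (y 0 - y i).
Proof.
congr mulmx; rewrite (bigD1 0)//= big1 ?addr0.
  by rewrite mxE eqxx; case: eqVneq => [->|_]; rewrite ?scale1r// subrr scaler0.
by move=> j /negPf j0; rewrite mxE j0 scale0r.
Qed.

Lemma star_graph_synchronizes (R : realType) (N n m q : nat)
    (A : 'M[R]_n) (B : 'M[R]_(n, m)) (C : 'M[R]_(q, n)) (K : 'M[R]_(m, q)) :
  hurwitz (A - B *m K *m C) -> synchronizes A B C K (star_graph R N).
Proof.
move=> HM x0 x traj.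
have e0 i : x i t - x 0 t @[t --> +oo] --> (0 : 'cV[R]_n).
  apply: (hurwitz_cvg0 HM) => t t0.
  have [_ _ /(_ t t0) di] := traj i; have [_ _ /(_ t t0) d0] := traj 0.
  have := is_deriveB di d0; congr is_derive.
  rewrite !coupling_star_graph subrr !mulmx0 addr0.
  rewrite -(mulmxBr C) !mulmxA -(opprB (x i t)) mulmxN mulmxBl.
  by rewrite (mulmxBr A) addrAC.
move=> i j.
have -> : (fun t => x i t - x j t) =
    (fun t => (x i t - x 0 t) - (x j t - x 0 t)).
  by apply/funext => t; rewrite opprB addrA subrK.
by rewrite -[X in _ --> X]subr0; apply: cvgB; exact: e0.
Qed.

Theorem theorem3 (R : realType) (n m q N : nat)
    (A : 'M[R]_n) (B : 'M[R]_(n, m)) (C : 'M[R]_(q, n))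
    (hN : (1 < N)%N) (hNeven : ~~ odd N) :
  output_feedback_synchronizable N A B C <->
  output_feedback_stabilizable A B C.
Proof.
(* N.+2 nodes leave a hyperplane of odd dimension N.+1. *)
case: N hN hNeven => [|[|N]]// _ Neven; split=> [[K [S [_ sync]]]|[K HK]].
  have Nodd : odd N.+1 by rewrite /= negbK in Neven.
  have [w [lam [w0 w1 wL]]] := odd_hyperplane_left_eigenvector Nodd (laplacian1 S).
  by exists (lam *: K); exact: (hurwitz_of_synchronizes w0 w1 wL sync).
exists K, (star_graph R N.+1); split; last exact: star_graph_synchronizes.
by move=> i; rewrite mxE andbN.
Qed.
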